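(* Let $\Gamma$ be a finitely generated abelian group, $\mathcal{A}$ a finite list of elements of $\Gamma$, and $G=\mathbb{S}^1$ or $G=\mathbb{C}^\times$. Then for every $q\in\mathbb{Z}_{>0}$, $$\chi^{q\text{-}\mathrm{par}}_{\mathcal{A}(G)}(q)=\chi^{\operatorname{quasi}}_{\mathcal{A}}(q).$$
   Context: $G$ is written multiplicatively; $T=\operatorname{Hom}(\Gamma,G)$ with identity $\mathbf{1}$. For $\alpha\in\mathcal{A}$, $H_{\alpha,G}=\{\varphi\in T\mid\varphi(\alpha)=1\}$; for $\mathcal{S}\subseteq\mathcal{A}$, $H_{\mathcal{S},G}=\bigcap_{\alpha\in\mathcal{S}}H_{\alpha,G}$ ($H_{\emptyset,G}=T$); each connected component of $H_{\mathcal{S},G}$ is isomorphic to $G^{r_\Gamma-r_{\mathcal{S}}}$ and is assigned dimension $r_\Gamma-r_{\mathcal{S}}$ ($r_{\mathcal{S}}$ the rank of $\langle\mathcal{S}\rangle$, $r_\Gamma$ the rank of $\Gamma$). $L$ is the set of connected components of all nonempty $H_{\mathcal{S},G}$, ordered by reverse inclusion, with Möbius function $\mu$; for $\mathcal{C}\in L$, $T^{\mathcal{C}}$ is the connected component of $T$ containing $\mathcal{C}$. $\mathcal{A}^{\operatorname{tor}}=\mathcal{A}\cap\Gamma_{\operatorname{tor}}$; $\mathrm{scc}(T)$ is the set of connected components $T_i$ of $T$ with no $\alpha\in\mathcal{A}^{\operatorname{tor}}$ such that $T_i\subseteq H_{\alpha,G}$; $L^{\mathrm{par}}=\{\mathcal{C}\in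 L\mid T^{\mathcal{C}}\in\mathrm{scc}(T)\}$. For $k\in\mathbb{Z}$, $E_k(\varphi)=\varphi^k$ and $L^{\mathrm{par}}[k]=\{\mathcal{C}\in L^{\mathrm{par}}\mid\mathbf{1}\in E_k(\mathcal{C})\}$; the $k$-partial characteristic polynomial is $\chi^{k\text{-}\mathrm{par}}_{\mathcal{A}(G)}(t)=\sum_{\mathcal{C}\in L^{\mathrm{par}}[k]}\mu(T^{\mathcal{C}},\mathcal{C})t^{\dim\mathcal{C}}$. The chromatic quasi-polynomial is $\chi^{\operatorname{quasi}}_{\mathcal{A}}(q)=\#\{\varphi\in\operatorname{Hom}(\Gamma,\mathbb{Z}/q\mathbb{Z})\mid\varphi(\alpha)\ne0\ \forall\alpha\in\mathcal{A}\}$. *)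

(* Defs.v *)
From HB Require Import structures.
From mathcomp Require Import all_boot all_order all_algebra.
From mathcomp Require Import all_classical all_reals all_analysis.
From mathcomp Require Import complex.
Import numFieldTopology.Exports numFieldNormedType.Exports.
Import Order.TTheory GRing.Theory Num.Theory.

Set Implicit Arguments.
Unset Strict Implicit.
Unset Printing Implicit Defensive.

Local Open Scope classical_set_scope.
Local Open Scope ring_scope.

(* The usual (metric) topology on the complex numbers R[i] = complex R,
   i.e. the one given by the complex modulus; 'rV[R[i]]_n = C^n then carries
   the product topology (library instance on matrices). *)
HB.instance Definition _ (R : rcfType) := PseudoPointedMetric.copy R[i] R[i]^o.

(* A finitely generated abelian group Gamma is given by a presentation      *)
(*   Gamma = Z^n / < Rel >,   Rel : seq 'rV[int]_n,                          *)
(* and an element of Gamma by an integer representative v : 'rV[int]_n.    *)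
(* A homomorphism phi : Gamma -> G (G a subgroup of C^x) is identified with *)
(* the vector t = (phi(e_1), ..., phi(e_n)) in G^n with phi(r) = 1 for all  *)
(* relations r; then phi(v) = prod_i t_i ^ v_i.                              *)

Section Arrangement.
Variable R : realType.
Local Notation CC := (R[i]).
Variable n : nat.
Variable G : set CC.
Variables Rel A : seq 'rV[int]_n.

Definition hev (t : 'rV[CC]_n) (v : 'rV[int]_n) : CC :=
  \prod_(i < n) (t 0 i) ^ (v 0 i).

Definition Ttorus : set 'rV[CC]_n :=
  [set t : 'rV[CC]_n | (forall i, G (t 0 i)) /\ (forall r, r \in Rel -> hev t r = 1)].

Definition Hsub (a : 'rV[int]_n) : set 'rV[CC]_n :=
  [set t : 'rV[CC]_n | Ttorus t /\ hev t a = 1].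

Definition HS (S : seq 'rV[int]_n) : set 'rV[CC]_n :=
  [set t : 'rV[CC]_n | Ttorus t /\ (forall a, a \in S -> hev t a = 1)].

Definition Lset : set (set 'rV[CC]_n) :=
  [set K | exists S : seq 'rV[int]_n, {subset S <= A} /\
           exists x, HS S x /\ K = connected_component (HS S) x].

Definition Lle (K1 K2 : set 'rV[CC]_n) : Prop := K2 `<=` K1.

Definition zrank (l : seq 'rV[int]_n) : nat :=
  \rank (\matrix_(i < size l, j < n) (((nth 0 l i) 0 j)%:~R : rat)).

Definition rank_Gamma : nat := (n - zrank Rel)%N.

Definition rank_sub (S : seq 'rV[int]_n) : nat :=
  (zrank (S ++ Rel) - zrank Rel)%N.

Definition vanishing (K : set 'rV[CC]_n) : seq 'rV[int]_n :=
  [seq a <- A | `[< K `<=` Hsub a >]].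

(* dim K = r_Gamma - r_S, for S = {alpha in A | K in H_alpha}
   (K is a connected component of H_{S,G} for this S) *)
Definition ldim (K : set 'rV[CC]_n) : nat :=
  (rank_Gamma - rank_sub (vanishing K))%N.

(* T^K : the connected component of T containing K *)
Definition Tcomp (K : set 'rV[CC]_n) : set 'rV[CC]_n :=
  \bigcup_(x in K) connected_component Ttorus x.

Definition is_torsion (a : 'rV[int]_n) : Prop :=
  exists m : nat, (0 < m)%N /\
    exists c : 'I_(size Rel) -> int,
      a *+ m = \sum_(j < size Rel) (nth 0 Rel j) *~ (c j).

Definition scc : set (set 'rV[CC]_n) :=
  [set D | (exists x, Ttorus x /\ D = connected_component Ttorus x) /\
           ~ (exists a, a \in A /\ is_torsion a /\ D `<=` Hsub a)].

Definition Lpar : set (set 'rV[CC]_n) :=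
  [set K | Lset K /\ scc (Tcomp K)].

Definition Lpark (k : int) : set (set 'rV[CC]_n) :=
  [set K | Lpar K /\ exists t, K t /\ forall i, (t 0 i) ^ k = 1].

Definition is_mobius (mu : set 'rV[CC]_n -> set 'rV[CC]_n -> int) : Prop :=
  (forall x y, Lset x -> Lset y -> Lle x y ->
     \sum_(z \in [set z | Lset z /\ Lle x z /\ Lle z y]) mu x z
       = (if `[< x = y >] then 1 else 0)) /\
  (forall x y, Lset x -> Lset y -> ~ Lle x y -> mu x y = 0).

Definition chi_par (mu : set 'rV[CC]_n -> set 'rV[CC]_n -> int) (k : int)
  : {poly int} :=
  \sum_(K \in Lpark k) (mu (Tcomp K) K)%:P * 'X^(ldim K).

End Arrangement.

(* chromatic quasi-polynomial: #{phi in Hom(Gamma, Z/qZ) | phi(alpha) <> 0 for all alpha in A};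
   phi is given by its values x_i in Z/qZ = {0,..,q-1} on the generators of Z^n *)
Definition chi_quasi (n : nat) (Rel A : seq 'rV[int]_n) (q : nat) : nat :=
  #|[set x : {ffun 'I_n -> 'I_q} |
      all (fun r : 'rV[int]_n => (q%:Z %| \sum_(i < n) r 0 i * (x i : nat)%:Z)%Z) Rel &&
      all (fun a : 'rV[int]_n => ~~ (q%:Z %| \sum_(i < n) a 0 i * (x i : nat)%:Z)%Z) A]|.

(* Main.v *)
(* Fix a primitive q-th root of unity: Hom(Gamma, Z/q) becomes the q-torsion
   T[q] of T.  A flat K is a coset of a torus of dimension dim K, so it contains
   q^(dim K) points of T[q] as soon as it contains one, and chi^(q-par)(q) is
   the sum over t in T[q] of mu(T^K, K) over the flats K of L^par through t.
   The flats through t form the interval from the component D of t in T to the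
   smallest flat F through t, so the inner sum is 1 if D = F lies in scc(T) and
   0 otherwise.  An element of A which is trivial on D is torsion, hence the
   condition says that no element of A vanishes at t.
   Components are handled through Smith normal form: in suitable coordinates
   s_j the group H_S is given by s_j^(e_j) = 1, and its components by fixing
   the s_j with e_j <> 0. *)
Require Import Defs.
From HB Require Import structures.
From mathcomp Require Import all_boot all_order all_algebra.
From mathcomp Require Import all_classical all_reals all_analysis.
From mathcomp Require Import complex.
Import numFieldTopology.Exports numFieldNormedType.Exports.
Import Order.TTheory GRing.Theory Num.Theory.
Local Open Scope classical_set_scope.
Local Open Scope ring_scope.

Set Implicit Arguments.
Unset Strict Implicit.
Unset Printing Implicit Defensive.

(** * Smith normal form and the rank of a diagonal matrix *)

Lemma Smith_diag_basis m n (M : 'M[int]_(m, n)) :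
  exists (U : 'M[int]_n) (e : 'rV[int]_n) X Y,
    [/\ U \in unitmx, M = X *m (diag_mx e *m U) & diag_mx e *m U = Y *m M].
Proof.
have [L uL [U uU [d _ ->]]] := int_Smith_normal_form M.
pose D : 'M[int]_(m, n) := \matrix_(i, j) (d`_i *+ (i == j :> nat)).
(* [e] is the Smith diagonal brought to length [n], padded by zeros if need be. The rectangular
   identity [I1] then passes between [D] and the square matrix [diag_mx e] in both directions. *)
pose e : 'rV[int]_n := \row_j (if (j < m)%N then d`_j else 0).
pose I1 : 'M[int]_(m, n) := \matrix_(i, j) (i == j :> nat)%:R.
have DE : D = I1 *m diag_mx e.
  apply/matrixP=> i j; rewrite mul_mx_diag !mxE mulr_natl.
  by case: eqP => [<-|]; rewrite ?ltn_ord ?mulr1n ?mulr0n.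
have eE : diag_mx e = I1^T *m D.
  apply/matrixP=> i j; rewrite !mxE.
  case: (ltnP i m) => im.
    rewrite (bigD1 (Ordinal im)) //= big1 ?addr0; last first.
      move=> k; rewrite -val_eqE /= => /negbTE ki.
      by rewrite !mxE ki mul0r.
    by rewrite !mxE /= eqxx mul1r.
  rewrite big1 ?mul0rn // => k _; rewrite !mxE.
  case: eqP => [ki|]; last by rewrite mul0r.
  by move: im; rewrite -ki leqNgt ltn_ord.
exists U, e, (L *m I1), (I1^T *m invmx L); split => //.
  by rewrite -/D DE !mulmxA.
by rewrite -/D eE -!mulmxA mulKmx.
Qed.

Lemma mxrank_diag (F : fieldType) n (e : 'rV[F]_n) :
  \rank (diag_mx e) = #|[pred j | e 0 j != 0]|.
Proof.
have E : (diag_mx e :=: \sum_(j | e 0 j != 0) <<delta_mx 0 j : 'rV_n>>)%MS.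
  apply/eqmxP/andP; split.
    apply/row_subP => j; rewrite row_diag_mx.
    have [->|ej] := eqVneq (e 0 j) 0; first by rewrite scale0r sub0mx.
    by rewrite scalemx_sub // (sumsmx_sup j) // genmxE.
  apply/sumsmx_subP => j ej; rewrite genmxE.
  have -> : delta_mx 0 j = (e 0 j)^-1 *: row j (diag_mx e).
    by rewrite row_diag_mx scalerA mulVf // scale1r.
  by rewrite scalemx_sub // row_sub.
rewrite E (mxdirectP (mxdirect_delta F (f := id) _)) /=; last by move=> ? ? _ _.
rewrite (eq_bigr (fun=> 1%N)) ?sum1_card // => j _.
by rewrite mxrank_gen mxrank_delta.
Qed.

Lemma row_diag_mul (S : nzRingType) m n (d : 'rV[S]_m) (A : 'M[S]_(m, n)) j :
  row j (diag_mx d *m A) = d 0 j *: row j A.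
Proof. by rewrite row_mul row_diag_mx -scalemxAl -rowE. Qed.

(** * Continuity and connectedness for complex-valued maps *)

Section Topology.
Variable R : realType.
Local Notation CC := R[i].

Lemma continuous_real_complex : continuous (real_complex R : R -> CC).
Proof.
move=> u; apply/(@cvgrPdist_lt CC CC^o) => /= e e0.
have [e' e'0 ->] : exists2 e' : R, 0 < e' & e = e'%:C%C.
  by case: e e0 => a b; rewrite ltcE /= => /andP[/eqP -> a0]; exists a.
near=> v.
rewrite -rmorphB /= normc_def /= expr0n addr0 sqrtr_sqr ltcR.
by near: v; apply: cvgr_dist_lt.
Unshelve. all: by end_near. Qed.

Lemma hausdorff_complex : hausdorff_space CC.
Proof. exact: (@norm_hausdorff CC CC^o). Qed.

Lemma continuous_exprz_complex (T : topologicalType) (f : T -> CC) (k : int) (x : T) :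
  f x != 0 -> {for x, continuous f} -> {for x, continuous (fun y => f y ^ k)}.
Proof.
move=> fx0 fc.
have E (m : nat) : {for x, continuous (fun y => f y ^+ m)}.
  elim: m => [|m IH].
    under [X in {for _, continuous X}]eq_fun do rewrite expr0.
    exact: cst_continuous.
  under [X in {for _, continuous X}]eq_fun do rewrite exprS.
  exact: (@continuousM CC T f _ x fc IH).
case: k => m; first exact: E.
have fm0 : f x ^+ m.+1 != 0 by rewrite expf_neq0.
exact: (@continuousV CC T (fun y => f y ^+ m.+1) x fm0 (E m.+1)).
Qed.

Lemma continuous_prod_complex (T : topologicalType) (I : finType) (f : I -> T -> CC) (x : T) :
  (forall i, {for x, continuous (f i)}) ->
  {for x, continuous (fun y => \prod_i f i y)}.
Proof.
move=> fc.
elim: (index_enum I) => [|i r IH].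
  under [X in {for _, continuous X}]eq_fun do rewrite big_nil.
  exact: cst_continuous.
under [X in {for _, continuous X}]eq_fun do rewrite big_cons.
exact: (@continuousM CC T (f i) _ x (fc i) IH).
Qed.

Lemma continuous_row (T : topologicalType) n (f : T -> 'rV[CC]_n) (x : T) :
  (forall j, {for x, continuous (fun y => f y 0 j)}) ->
  {for x, continuous f}.
Proof.
move=> fc A [P nP PA]; rewrite /nbhs /=.
have : \forall y \near x, forall j, P 0 j (f y 0 j).
  apply: filter_forall => j.
  exact: fc (nP 0 j).
apply: filterS => y Py; apply: PA => i j; rewrite ord1; exact: Py.
Qed.

(** The image is connected, and since it sits in a finite subset of a Hausdorff space each of its
    points is open and closed in it; so it is a single point. *)
Lemma connected_finite_const (T : topologicalType) (A : set T) (F : set CC) (f : T -> CC) x y :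
  connected A -> {within A, continuous f} -> finite_set F -> f @` A `<=` F ->
  A x -> A y -> f x = f y.
Proof.
move=> cA fc finF fAF Ax Ay.
have cfA := connected_continuous_connected cA fc.
have acc := hausdorff_accessible hausdorff_complex.
have fincl := proj1 accessible_finite_set_closed acc.
suff E : [set f x] = f @` A.
  have : (f @` A) (f y) by exists y.
  by rewrite -E => /= ->.
apply: cfA; first by exists (f x).
  exists (~` (F `\ f x)).
    by apply: closed_openC; apply: fincl; apply: finite_setD.
  apply/seteqP; split=> z /=.
    by move=> ->; split; [exists x|case].
  case=> zA zF; apply: contrapT => zx; apply: zF; split => //; exact: fAF.
exists [set f x]; first exact: fincl.
apply/seteqP; split=> z /= [] //.
by move=> ->; split => //; exists x.
Qed.

End Topology.

(** In characteristic 0 the polynomial X^m - 1 is separable, so it has m distinct roots, and such a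
    full list of m-th roots of unity contains a primitive one. *)
Lemma exists_prim_root (C : numClosedFieldType) m :
  (0 < m)%N -> exists z : C, m.-primitive_root z.
Proof.
move=> m0; have [r Dr] := closed_field_poly_normal ('X^m - 1 : {poly C}).
rewrite (monicP _) ?monicXnsubC // scale1r in Dr.
have rm1 : all m.-unity_root r by apply/allP => z; rewrite -root_prod_XsubC -Dr.
have sz_r : (m < (size r).+1)%N by rewrite -(size_prod_XsubC r id) -Dr size_XnsubC.
have ur : uniq r.
  by rewrite -separable.separable_prod_XsubC -Dr cyclotomic.separable_Xn_sub_1 // pnatr_eq0 -lt0n.
by have /hasP[z _ zP] := cyclic.has_prim_root m0 rm1 ur sz_r; exists z.
Qed.

(** * The two groups G: the circle and the punctured plane *)

Section Group.
Variable R : realType.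
Local Notation CC := R[i].
Variable G : set CC.
Hypothesis HG : G = [set z : CC | `|z| = 1] \/ G = [set z : CC | z != 0].

Lemma G_neq0 z : G z -> z != 0.
Proof.
case: HG => -> //= z1; apply/eqP => z0; move: z1.
by rewrite z0 normr0 => /eqP; rewrite eq_sym oner_eq0.
Qed.

Lemma G_mul z w : G z -> G w -> G (z * w).
Proof.
case: HG => -> /=; first by move=> z1 w1; rewrite normrM z1 w1 mulr1.
by move=> z0 w0; rewrite mulf_neq0.
Qed.

Lemma G_one : G 1.
Proof. by case: HG => -> /=; [exact: normr1 | exact: oner_neq0]. Qed.

Lemma G_exprz z (k : int) : G z -> G (z ^ k).
Proof.
case: HG => -> /=; last by move=> z0; rewrite expfz_neq0.
move=> z1; case: k => m; first by rewrite -exprnP normrX z1 expr1n.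
by rewrite NegzE -exprnN normfV normrX z1 expr1n invr1.
Qed.

Lemma G_unity z m : (0 < m)%N -> z ^+ m = 1 -> G z.
Proof.
move=> m0 zm1; case: HG => -> /=.
  by apply/eqP; rewrite -(@pexpr_eq1 _ _ m) // -normrX zm1 normr1.
by apply/eqP => z0; move/eqP: zm1; rewrite z0 expr0n -[m == _]negbK -lt0n m0 eq_sym oner_eq0.
Qed.

(* The segment from 1 to a square root w of z with Re w >= 0 avoids 0; its square,
   normalised when G is the circle, joins 1 to z. *)
Lemma G_path z : G z -> exists g : R -> CC,
  [/\ forall u, u \in `[0, 1] -> {for u, continuous g},
      forall u, u \in `[0, 1] -> G (g u), g 0 = 1 & g 1 = z].
Proof.
move=> Gz; have z0 := G_neq0 Gz.
have [w wz Rew] : exists2 w : CC, w ^+ 2 = z & 0 <= complex.Re w.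
  have [|] := leP 0 (complex.Re (sqrtC z)); first by exists (sqrtC z); rewrite ?sqrtCK.
  by exists (- sqrtC z); rewrite ?sqrrN ?sqrtCK // raddfN /= oppr_ge0 ltW.
have w0 : w != 0 by apply: contraNneq z0 => w0; rewrite -wz w0 expr0n.
pose p (u : R) : CC := (1 - u)%:C%C + u%:C%C * w.
have p00 : p 0 = 1 by rewrite /p subr0 mul0r addr0.
have p11 : p 1 = w by rewrite /p subrr add0r mul1r.
have p0 u : u \in `[0, 1] -> p u != 0.
  rewrite in_itv /= => /andP[u0 u1]; apply/eqP => pu0.
  have : complex.Re (p u) = 0 by rewrite pu0.
  have -> : complex.Re (p u) = (1 - u) + u * complex.Re w.
    by rewrite /p; case: (w) => a b /=; rewrite mul0r subr0.
  (* Both summands are nonnegative, so both vanish; then [u] is 1 and [p u] is [w], which is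
     nonzero. *)
  move/eqP; rewrite paddr_eq0 ?subr_ge0 ?mulr_ge0 // subr_eq0 => /andP[/eqP u1' _].
  by move: pu0; rewrite -u1' p11; apply/eqP.
have pc u : {for u, continuous p}.
  apply: (@continuousD CC CC^o R (fun u => (1 - u)%:C%C) (fun u => u%:C%C * w)).
    apply: (@continuous_comp _ _ _ (fun u : R => 1 - u) (real_complex R)).
      by apply: continuousB; [exact: cst_continuous | exact: id].
    exact: continuous_real_complex.
  apply: (@continuousM CC R (real_complex R) (fun=> w)).
    exact: continuous_real_complex.
  exact: cst_continuous.
case: HG => E.
  have w1 : `|w| = 1.
    apply/eqP; rewrite -(@pexpr_eq1 _ _ 2) // -normrX wz.
    by move: Gz; rewrite E /= => ->.
  exists (fun u => (p u / `|p u|) ^+ 2); split.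
  - move=> u u01.
    have np0 : `|p u| != 0 by rewrite normr_eq0 p0.
    have nc : {for u, continuous (fun u => `|p u|)}.
      apply: (@continuous_comp _ _ _ p (Num.Def.normr : CC -> CC)) => //.
      exact: (@norm_continuous CC CC^o).
    have qc : {for u, continuous (fun u => p u / `|p u|)}.
      have vc := @continuousV CC R (fun u => `|p u|) u np0 nc.
      exact: (@continuousM CC R p _ u (pc u) vc).
    under [X in {for _, continuous X}]eq_fun do rewrite expr2.
    exact: (@continuousM CC R _ _ u qc qc).
  - move=> u u01; rewrite E /= normrX normrM normfV normr_id divff ?expr1n //.
    by rewrite normr_eq0 p0.
  - by rewrite p00 normr1 divr1 expr1n.
  - by rewrite p11 w1 divr1.
exists (fun u => (p u) ^+ 2); split.
- move=> u u01.
  under [X in {for _, continuous X}]eq_fun do rewrite expr2.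
  exact: (@continuousM CC R _ _ u (pc u) (pc u)).
- by move=> u u01; rewrite E /= expf_neq0 // p0.
- by rewrite p00 expr1n.
- by rewrite p11.
Qed.

End Group.

(** * Characters and monomial changes of coordinates *)

Section Monomials.
Variables (R : realType) (n : nat).
Local Notation CC := R[i].
Implicit Types (t : 'rV[CC]_n) (v w : 'rV[int]_n).

Lemma hev0 t : hev t 0 = 1.
Proof. by rewrite /hev big1 // => i _; rewrite mxE expr0z. Qed.

Lemma hevD t v w : (forall i, t 0 i != 0) -> hev t (v + w) = hev t v * hev t w.
Proof.
move=> t0; rewrite /hev -big_split; apply: eq_bigr => i _.
by rewrite mxE expfzDr.
Qed.

Lemma hevZ t (c : int) v : hev t (c *: v) = hev t v ^ c.
Proof.
rewrite /hev (big_morph (fun z : CC => z ^ c) (fun a b => expfzMl a b c) (exp1rz _ c)).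
by apply: eq_bigr => i _; rewrite mxE exprz_exp mulrC.
Qed.

Lemma hev_row1 t i : hev t (row i 1%:M) = t 0 i.
Proof.
rewrite /hev (bigD1 i) //= !mxE eqxx expr1z big1 ?mulr1 // => j ji.
by rewrite !mxE eq_sym (negbTE ji) expr0z.
Qed.

End Monomials.

(** The homomorphism of tori dual to the integer matrix [U]. For invertible [U] it is a change of
    coordinates on the torus. *)
Definition mon (R : realType) m n (t : 'rV[R[i]]_n) (U : 'M[int]_(m, n)) : 'rV[R[i]]_m :=
  \row_j hev t (row j U).

Section MonomialMaps.
Variable R : realType.
Local Notation CC := R[i].

Lemma hev_mulmx m n (t : 'rV[CC]_n) (v : 'rV[int]_m) (U : 'M[int]_(m, n)) :
  (forall i, t 0 i != 0) -> hev t (v *m U) = hev (mon t U) v.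
Proof.
move=> t0; rewrite mulmx_sum_row.
rewrite (big_morph (hev t) (fun a b => hevD a b t0) (hev0 t)).
by apply: eq_bigr => j _; rewrite hevZ mxE.
Qed.

Lemma mon_neq0 m n (t : 'rV[CC]_n) (U : 'M[int]_(m, n)) i :
  (forall i, t 0 i != 0) -> mon t U 0 i != 0.
Proof.
by move=> t0; rewrite mxE; apply/prodf_neq0 => k _; rewrite expfz_neq0.
Qed.

Lemma mon_mon m n p (t : 'rV[CC]_n) (U : 'M[int]_(m, n)) (W : 'M[int]_(p, m)) :
  (forall i, t 0 i != 0) -> mon (mon t U) W = mon t (W *m U).
Proof. by move=> t0; apply/rowP=> j; rewrite !mxE row_mul hev_mulmx. Qed.

Lemma mon1 n (t : 'rV[CC]_n) : mon t 1%:M = t.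
Proof. by apply/rowP=> j; rewrite mxE hev_row1. Qed.

Lemma mon_invK n (t : 'rV[CC]_n) (U : 'M[int]_n) :
  U \in unitmx -> (forall i, t 0 i != 0) -> mon (mon t U) (invmx U) = t.
Proof. by move=> uU t0; rewrite mon_mon // mulVmx // mon1. Qed.

Lemma mon_invKV n (t : 'rV[CC]_n) (U : 'M[int]_n) :
  U \in unitmx -> (forall i, t 0 i != 0) -> mon (mon t (invmx U)) U = t.
Proof. by move=> uU t0; rewrite mon_mon // mulmxV // mon1. Qed.

Lemma continuous_hev n (t : 'rV[CC]_n) (v : 'rV[int]_n) :
  (forall i, t 0 i != 0) -> {for t, continuous (fun t => hev t v)}.
Proof.
move=> t0; apply: continuous_prod_complex => i.
apply: continuous_exprz_complex => //.
exact: (@coord_continuous CC).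
Qed.

Lemma mon_unity m n q (t : 'rV[CC]_n) (U : 'M[int]_(m, n)) j :
  (forall i, t 0 i ^+ q = 1) -> mon t U 0 j ^+ q = 1.
Proof.
move=> tq; rewrite mxE /hev -prodrXl big1 // => i _.
by rewrite -[_ ^+ q]/(_ ^ q%:Z) exprz_exp mulrC -exprz_exp -exprnP tq exp1rz.
Qed.

End MonomialMaps.

(** * Stacked bases of sublattices of Z^n, and rational rank *)

Definition rows n (B : seq 'rV[int]_n) : 'M[int]_(size B, n) :=
  \matrix_(i < size B) nth 0 B i.

(* The rows of U form a basis of Z^n, and their multiples e_j U_j generate <B>. *)
Definition stacked_basis n (B : seq 'rV[int]_n) (U : 'M[int]_n) (e : 'rV[int]_n) :=
  [/\ U \in unitmx, exists X, rows B = X *m (diag_mx e *m U)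
    & exists Y, diag_mx e *m U = Y *m rows B].

Section Rows.
Variables (n : nat) (B : seq 'rV[int]_n).

Lemma rows_mem (i : 'I_(size B)) : row i (rows B) \in B.
Proof. by rewrite rowK mem_nth. Qed.

Lemma mem_rows b : b \in B -> exists i, b = row i (rows B).
Proof.
move=> bB; have ib : (index b B < size B)%N by rewrite index_mem.
by exists (Ordinal ib); rewrite rowK /= nth_index.
Qed.

End Rows.

Section StackedBasis.
Variables (n : nat) (B : seq 'rV[int]_n).

Lemma stacked_basis_exists : exists U e, stacked_basis B U e.
Proof.
have [U [e [X [Y [uU H1 H2]]]]] := Smith_diag_basis (rows B).
by exists U, e; split => //; [exists X | exists Y].
Qed.

Lemma zrankE : zrank B = \rank (map_mx (intr : int -> rat) (rows B)).
Proof. by congr (\rank _); apply/matrixP=> i j; rewrite !mxE. Qed.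

(** Over the rationals [B] and the stacked generators span the same row space, and [U] becomes
    invertible, so only the diagonal matters. *)
Lemma zrank_stacked_basis U e : stacked_basis B U e -> zrank B = #|[pred j | e 0 j != 0]|.
Proof.
case=> uU [X HX] [Y HY].
have E : (map_mx (intr : int -> rat) (rows B) :=: map_mx intr (diag_mx e *m U))%MS.
  by apply/eqmxP/andP; split; [rewrite HX | rewrite HY]; rewrite [in X in (X <= _)%MS]map_mxM submxMl.
rewrite zrankE E map_mxM mxrankMfree; last first.
  rewrite row_free_unit unitmxE -[map_mx _ _]/(map_mx (intmul 1) _) det_map_mx unitfE.
  rewrite intr_eq0; apply: contraTneq uU => U0.
  by rewrite unitmxE U0 unitr0.
rewrite map_diag_mx mxrank_diag; apply: eq_card => j.
by rewrite !inE !mxE intr_eq0.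
Qed.

(** Over the rationals one may divide by the multiplier [m], so the extra vectors already lie in the
    row space of [B]. *)
Lemma zrank_sat (B' : seq 'rV[int]_n) :
  {subset B <= B'} ->
  (forall b, b \in B' -> exists m c, (0 < m)%N /\ b *+ m = c *m rows B) ->
  zrank B' = zrank B.
Proof.
move=> sB sat; rewrite /zrank.
set M' := (X in \rank X = _); set M := (X in _ = \rank X).
have ME : M = map_mx (intr : int -> rat) (rows B).
  by apply/matrixP=> i j; rewrite !mxE.
suff E : (M' :=: M)%MS by rewrite E.
apply/eqmxP/andP; split; apply/row_subP => i.
  have [m [c [m0 mc]]] := sat _ (mem_nth 0 (ltn_ord i)).
  have -> : row i M' = (m%:R)^-1 *: (map_mx intr c *m M).
    rewrite ME -map_mxM -mc; apply/rowP=> j; rewrite !mxE mulmxnE.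
    rewrite [in RHS]rmorphMn /= -[X in _ = _ * X]mulr_natl mulrA mulVf ?mul1r //.
    by rewrite pnatr_eq0 -lt0n.
  by rewrite scalemx_sub // submxMl.
have iB := sB _ (mem_nth 0 (ltn_ord i)).
have [i' ii'] := mem_rows iB.
have -> : row i M = row i' M'.
  by apply/rowP=> j; rewrite !mxE ii' !mxE.
exact: row_sub.
Qed.

End StackedBasis.

(** * Connected components of a single group [Ttorus G B] *)

Section Components.
Variables (R : realType) (n : nat).
Local Notation CC := R[i].
Variable G : set CC.
Hypothesis HG : G = [set z : CC | `|z| = 1] \/ G = [set z : CC | z != 0].

Lemma G_mon m (t : 'rV[CC]_n) (U : 'M[int]_(m, n)) j :
  (forall i, G (t 0 i)) -> G (mon t U 0 j).
Proof.
move=> Gt; rewrite mxE /hev; elim/big_ind: _ => [|? ?|i _].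
- exact: G_one.
- exact: G_mul.
- exact: G_exprz.
Qed.

Section OneTorus.
Variables (B : seq 'rV[int]_n) (U : 'M[int]_n) (e : 'rV[int]_n).
Hypothesis HU : stacked_basis B U e.
Local Notation TB := (Ttorus G B).

Lemma stacked_basis_unit : U \in unitmx. Proof. by case: HU. Qed.
Let uU := stacked_basis_unit.

Lemma Ttorus_neq0 t : TB t -> forall i, t 0 i != 0.
Proof. by case=> Gt _ i; exact: (G_neq0 HG (Gt i)). Qed.

(** The vectors of [B] and the stacked generators e_j U_j are integer combinations of each other, so
    a character is trivial on one family exactly when it is trivial on the other. *)
Lemma TtorusP (t : 'rV[CC]_n) : (forall i, G (t 0 i)) ->
  TB t <-> forall j, mon t U 0 j ^ e 0 j = 1.
Proof.
move=> Gt; have t0 i := G_neq0 HG (Gt i).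
case: HU => _ [X HX] [Y HY]; split.
  case=> _ tB j; rewrite mxE -hevZ -row_diag_mul HY row_mul hev_mulmx //.
  rewrite /hev big1 // => i _; rewrite mxE tB ?exp1rz //; exact: rows_mem.
move=> tj; split=> // b /mem_rows [i ->].
rewrite HX row_mul hev_mulmx // /hev big1 // => j _.
by rewrite mxE row_diag_mul hevZ; have := tj j; rewrite mxE => ->; rewrite exp1rz.
Qed.

(** Such a coordinate is a root of unity of order dividing [e 0 j]. Having finitely many values, it
    is constant on connected sets. *)
Lemma mon_mem_finite_set j : e 0 j != 0 ->
  exists F : set CC, finite_set F /\ forall t, TB t -> F (hev t (row j U)).
Proof.
move=> ej; have m0 : leq 1 (absz (e 0 j)) by rewrite absz_gt0.
have [z zP] := exists_prim_root CC m0.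
exists [set z ^+ (i : nat) | i in [set: 'I_(absz (e 0 j))]]; split.
  exact/finite_image/finite_finset.
move=> t Tt; have Gt : forall i, G (t 0 i) by case: Tt.
have := proj1 (TtorusP Gt) Tt j; rewrite mxE => H.
have {}H : hev t (row j U) ^+ absz (e 0 j) = 1.
  have := H; case: (e 0 j) => k //=; rewrite NegzE -exprnN => /eqP.
  by rewrite invr_eq1 => /eqP.
by have [i ->] := prim_rootP zP H; exists i.
Qed.

Lemma TtorusE x : TB x -> forall t : 'rV[CC]_n, (forall i, G (t 0 i)) ->
  (forall j, e 0 j != 0 -> hev t (row j U) = hev x (row j U)) -> TB t.
Proof.
move=> Tx t Gt tx; apply/TtorusP => // j.
have [-> //|ej] := eqVneq (e 0 j) 0.
have Gx : forall i, G (x 0 i) by case: Tx.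
by have := proj1 (TtorusP Gx) Tx j; rewrite !mxE tx.
Qed.

Lemma component_const x t j : TB x -> connected_component TB x t ->
  e 0 j != 0 -> hev t (row j U) = hev x (row j U).
Proof.
move=> Tx [C [Cx CT cC] Ct] ej.
have [F [finF FT]] := mon_mem_finite_set ej.
apply: (connected_finite_const (f := fun t => hev t (row j U)) cC _ finF) => //.
  apply: continuous_in_subspaceT => y /set_mem Cy.
  by apply: continuous_hev; exact: Ttorus_neq0 (CT _ Cy).
by move=> _ [y Cy <-]; apply: FT; exact: CT.
Qed.

(** In the coordinates given by [U], each coordinate with [e 0 j = 0] is moved along a path in G
    while the others stay fixed. The curve never leaves the group, so its image is a connected
    subset containing both points. *)
Lemma component_path x t : TB x -> TB t ->
  (forall j, e 0 j != 0 -> hev t (row j U) = hev x (row j U)) ->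
  connected_component TB x t.
Proof.
move=> Tx Tt tx.
have [Gx Gt] : (forall i, G (x 0 i)) /\ (forall i, G (t 0 i)) by case: Tx; case: Tt.
have x0 := Ttorus_neq0 Tx; have t0 := Ttorus_neq0 Tt.
have : forall j, exists g : R -> CC,
  [/\ forall u, u \in `[0, 1] -> {for u, continuous g},
      forall u, u \in `[0, 1] -> G (g u),
      g 0 = mon x U 0 j, g 1 = mon t U 0 j &
      e 0 j != 0 -> forall u, g u = mon x U 0 j].
  move=> j; have [ej|ej] := eqVneq (e 0 j) 0; last first.
    exists (fun=> mon x U 0 j); split => // [u _|u _|].
    - exact: cst_continuous.
    - exact: G_mon.
    - by rewrite !mxE tx.
  (* A path from 1 to the ratio of the two coordinates, multiplied by the coordinate of [x], joins
     them inside G. *)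
  have Gz : G (mon t U 0 j * (mon x U 0 j) ^ (-1)).
    by apply: G_mul => //; [exact: G_mon | apply: G_exprz => //; exact: G_mon].
  have [g [gc Gg g0 g1]] := G_path HG Gz.
  exists (fun u => mon x U 0 j * g u); split.
  - move=> u u01; have cc : {for u, continuous (fun=> mon x U 0 j : CC)} by exact: cst_continuous.
    exact: (@continuousM CC R (fun=> mon x U 0 j : CC) g u cc (gc u u01)).
  - by move=> u u01; apply: G_mul => //; [exact: G_mon | exact: Gg].
  - by rewrite g0 mulr1.
  - by rewrite g1 mulrC -mulrA mulVf ?mulr1 // mon_neq0.
  - by [].
move=> /choice [g gP].
pose s u : 'rV[CC]_n := \row_j g j u.
have Gs u i : u \in `[0, 1] -> G (s u 0 i).
  by move=> u01; rewrite mxE; have [_ Gg _ _ _] := gP i; exact: Gg.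
have s0 u i : u \in `[0, 1] -> s u 0 i != 0.
  by move=> u01; exact: (G_neq0 HG (Gs u i u01)).
pose f u := mon (s u) (invmx U).
have Gf u : u \in `[0, 1] -> forall i, G (f u 0 i).
  by move=> u01 i; apply: G_mon => k; exact: Gs.
have fU u j : u \in `[0, 1] -> hev (f u) (row j U) = g j u.
  move=> u01; have := mon_invKV uU (fun i => s0 u i u01).
  by move/rowP/(_ j); rewrite !mxE.
have f0 : f 0 = x.
  rewrite -[RHS](mon_invK uU x0); congr (mon _ _).
  by apply/rowP=> j; rewrite mxE; have [_ _ -> _ _] := gP j.
have f1 : f 1 = t.
  rewrite -[RHS](mon_invK uU t0); congr (mon _ _).
  by apply/rowP=> j; rewrite mxE; have [_ _ _ -> _] := gP j.
have fc u : u \in `[0, 1] -> {for u, continuous f}.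
  move=> u01; apply: continuous_row => j.
  rewrite /f; under [X in {for _, continuous X}]eq_fun do rewrite mxE.
  apply: (@continuous_comp _ _ _ s (fun t => hev t (row j (invmx U)))).
    apply: continuous_row => k.
    under [X in {for _, continuous X}]eq_fun do rewrite mxE.
    by have [gc _ _ _ _] := gP k; exact: gc.
  by apply: continuous_hev => i; exact: s0.
have i0 : (0 : R) \in `[0, 1] by rewrite in_itv /= lexx ler01.
have i1 : (1 : R) \in `[0, 1] by rewrite in_itv /= lexx ler01.
apply: (@connected_component_max _ TB (f @` `[0, 1])).
- by exists 0.
- move=> _ [u u01 <-]; apply: (TtorusE Tx); first exact: Gf.
  move=> j ej; rewrite fU //; have [_ _ _ _ ->] := gP j => //.
  by rewrite mxE.
- apply: connected_continuous_connected; first exact: segment_connected.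
  by apply: continuous_in_subspaceT => u /set_mem u01; exact: fc.
- by exists 1.
Qed.

Lemma componentP x : TB x -> forall t,
  connected_component TB x t <->
  TB t /\ forall j, e 0 j != 0 -> hev t (row j U) = hev x (row j U).
Proof.
move=> Tx t; split=> [xt|[Tt tx]]; last exact: component_path.
split; first exact: connected_component_sub xt.
by move=> j ej; exact: component_const xt ej.
Qed.

End OneTorus.
End Components.

(** * The q-torsion points, indexed by the same type as in [chi_quasi] *)

Definition root_point (R : realType) n q (z : R[i]) (k : {ffun 'I_n -> 'I_q}) : 'rV[R[i]]_n :=
  \row_i z ^+ k i.

Section RootPoints.
Variables (R : realType) (n q : nat) (z : R[i]).
Hypothesis zP : q.-primitive_root z.
Local Notation pt := (root_point z).

Lemma root_pointX (k : {ffun 'I_n -> 'I_q}) i : pt k 0 i ^+ q = 1.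
Proof. by rewrite mxE exprAC (prim_expr_order zP) expr1n. Qed.

Lemma root_point_inj : injective (@root_point R n q z).
Proof.
move=> k k' /rowP kk'; apply/ffunP => i; apply: val_inj => /=.
have := kk' i; rewrite !mxE => /eqP; rewrite (eq_prim_root_expr zP).
by rewrite !modn_small // => /eqP.
Qed.

Lemma root_point_surj (t : 'rV[R[i]]_n) : (forall i, t 0 i ^+ q = 1) ->
  exists k : {ffun 'I_n -> 'I_q}, t = pt k.
Proof.
move=> tq; have H i := prim_rootP zP (tq i).
exists [ffun i => sval (H i)]; apply/rowP=> i; rewrite mxE ffunE.
by case: (H i).
Qed.

End RootPoints.

(** * Torsion points on components, vanishing characters, finiteness *)

Section ComponentsTheory.
Variables (R : realType) (n : nat).
Local Notation CC := R[i].
Variable G : set CC.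
Hypothesis HG : G = [set z : CC | `|z| = 1] \/ G = [set z : CC | z != 0].

(** The coordinate change permutes the q-torsion points. On the component the coordinates with
    [e 0 j != 0] are fixed and the remaining [n - zrank B] range freely over q values. *)
Lemma card_component_root_points (B : seq 'rV[int]_n) q (z : CC) x (k0 : {ffun 'I_n -> 'I_q}) :
  q.-primitive_root z -> Ttorus G B x ->
  connected_component (Ttorus G B) x (root_point z k0) ->
  #|[pred k : {ffun 'I_n -> 'I_q} |
     `[< connected_component (Ttorus G B) x (root_point z k) >]]| = (q ^ (n - zrank B))%N.
Proof.
move=> zP Tx xk0.
have [U [e HU]] := stacked_basis_exists B; have uU := stacked_basis_unit HU.
have q0 := prim_order_gt0 zP.
have ptG (k : {ffun 'I_n -> 'I_q}) i : G (root_point z k 0 i).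
  exact: (G_unity HG q0 (root_pointX zP k i)).
have pt0 (k : {ffun 'I_n -> 'I_q}) i : root_point z k 0 i != 0.
  exact: (G_neq0 HG (ptG k i)).
have /choice [f fP] : forall k : {ffun 'I_n -> 'I_q}, exists k' : {ffun 'I_n -> 'I_q},
    mon (root_point z k) U = root_point z k'.
  move=> k; apply: (root_point_surj zP) => j; apply: mon_unity => i.
  exact: (root_pointX zP).
have fI : injective f.
  move=> k k' ff; apply: (root_point_inj zP).
  have := etrans (fP k) (etrans (congr1 _ ff) (esym (fP k'))).
  move=> /(congr1 (fun t => mon t (invmx U))).
  by move=> H; apply: etrans (mon_invK uU (pt0 k')); rewrite -(mon_invK uU (pt0 k)).
have fE k j : hev (root_point z k) (row j U) = z ^+ f k j.
  by have /rowP/(_ j) := fP k; rewrite !mxE.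
have zI (a b : 'I_q) : z ^+ a = z ^+ b -> a = b.
  move=> /eqP; rewrite (eq_prim_root_expr zP) !modn_small // => /eqP.
  exact: val_inj.
(* The fixed coordinates are read off [k0], since [x] itself need not be a torsion point. *)
pose F j : pred 'I_q := if e 0 j == 0 then predT else pred1 (f k0 j).
have [Tk0 xk0'] := proj1 (componentP HG HU Tx _) xk0.
have kE k : `[< connected_component (Ttorus G B) x (root_point z k) >] = (f k \in family F).
  apply/asboolP/familyP => [/(componentP HG HU Tx) [_ xk] j|kF].
    rewrite /F; case: eqP => // /eqP ej; rewrite inE; apply/eqP/zI.
    exact: (etrans (esym (fE k j)) (etrans (xk j ej) (etrans (esym (xk0' j ej)) (fE k0 j)))).
  have H j : e 0 j != 0 -> hev (root_point z k) (row j U) = hev x (row j U).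
    move=> ej; have := kF j; rewrite /F (negbTE ej) inE => /eqP fk.
    exact: (etrans (fE k j) (etrans (congr1 (fun a : 'I_q => z ^+ a) fk)
      (etrans (esym (fE k0 j)) (xk0' j ej)))).
  apply/(componentP HG HU Tx); split; last exact: H.
  exact: (TtorusE HG HU Tx (ptG k) H).
transitivity #|family F|.
  (* An injective self-map of a finite type is onto, so taking the preimage under [f] preserves the
     cardinality. *)
  rewrite -(eq_card (A := [preim f of family F])) => [|k]; last by rewrite !inE kE.
  rewrite card_preim //; apply: eq_card => k; rewrite inE /=.
  by rewrite (injF_onto fI k).
rewrite card_family foldrE big_map big_enum /=.
rewrite (eq_bigr (fun j => if e 0 j == 0 then q else 1%N)); last first.
  by move=> j _; rewrite /F; case: eqP => _; rewrite ?card_ord ?card1.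
rewrite -big_mkcond prod_nat_const (zrank_stacked_basis HU); congr (_ ^ _)%N.
have := cardC [pred j | e 0 j != 0]; rewrite card_ord.
move=> /(congr1 (subn^~ #|[pred j | e 0 j != 0]|)) <-; rewrite /= addKn.
by apply: eq_card => j; rewrite !inE negbK.
Qed.

(** A character trivial on a component cannot involve the free coordinates. It is thus a combination
    of the U_j with [e 0 j != 0], and clearing these e_j puts a multiple of it in the lattice of
    [B]. *)
Lemma component_vanish_sat (B : seq 'rV[int]_n) x a :
  Ttorus G B x -> (forall t, connected_component (Ttorus G B) x t -> hev t a = 1) ->
  exists m c, (0 < m)%N /\ a *+ m = c *m rows B.
Proof.
move=> Tx xa.
have [U [e HU]] := stacked_basis_exists B; have uU := stacked_basis_unit HU.
have Gx : forall i, G (x 0 i) by case: Tx.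
have x0 i := G_neq0 HG (Gx i).
pose v := a *m invmx U.
have aE : a = v *m U by rewrite /v mulmxKV.
have v0 j : e 0 j = 0 -> v 0 j = 0.
  (* The coordinate j is free: multiply it by a root of unity of order |v_j| + 1. *)
  move=> ej; have [z zP] := exists_prim_root CC (ltn0Sn (absz (v 0 j))).
  pose s := \row_i (mon x U 0 i * (if i == j then z else 1)).
  have Gz : G z by apply: (G_unity HG (ltn0Sn (absz (v 0 j)))); exact: prim_expr_order zP.
  have Gs i : G (s 0 i).
    rewrite mxE; apply: (G_mul HG); first exact: (G_mon HG).
    by case: eqP => _; [exact: Gz | exact: (G_one HG)].
  have s0 i := G_neq0 HG (Gs i).
  pose t := mon s (invmx U).
  have Gt i : G (t 0 i) by apply: (G_mon HG).
  have tU : mon t U = s by exact: mon_invKV.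
  have xt : connected_component (Ttorus G B) x t.
    apply/(componentP HG HU Tx).
    have H i : e 0 i != 0 -> hev t (row i U) = hev x (row i U).
      move=> ei; have /rowP/(_ i) := tU; rewrite !mxE => ->.
      by case: eqP => [ij|_]; [move: ei; rewrite ij ej eqxx | rewrite mulr1].
    by split; [exact: (TtorusE HG HU Tx Gt H) | exact: H].
  have := xa t xt; rewrite aE hev_mulmx ?tU; last by move=> i; exact: (G_neq0 HG (Gt i)).
  have := xa x (connected_component_refl Tx); rewrite aE hev_mulmx //.
  have -> : hev s v = hev (mon x U) v * z ^ v 0 j.
    rewrite /hev (bigD1 j) //= [in RHS](bigD1 j) //= mxE eqxx expfzMl.
    rewrite mulrAC; congr (_ * _ * _); apply: eq_bigr => i ij.
    by rewrite mxE (negbTE ij) mulr1.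
  move=> ->; rewrite mul1r => zv.
  have {}zv : z ^+ absz (v 0 j) = 1.
    move: zv; case: (v 0 j) => k //=; rewrite NegzE -exprnN => /eqP.
    by rewrite invr_eq1 => /eqP.
  have := prim_order_dvd zP (absz (v 0 j)); rewrite zv eqxx.
  have [/eqP|pos] := posnP (absz (v 0 j)); first by rewrite absz_eq0 => /eqP.
  by move=> /(dvdn_leq pos); rewrite ltnn.
(* Every nonzero e_j divides [m], so e_j divides m v_j. Where e_j is zero, v_j is zero too, and the
   quotient 0 by 0 has the right value 0. *)
pose m := (\prod_(j | e 0%R j != 0%R) absz (e 0%R j))%N.
have dv j : (e 0%R j %| m%:Z * v 0%R j)%Z.
  have [ej|ej] := eqVneq (e 0 j) 0; first by rewrite v0 // mulr0 dvdz0.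
  by apply: dvdz_mulr; rewrite /m (bigD1 j) //= PoszM dvdz_mulr // dvdzE.
pose c : 'rV[int]_n := \row_j (m%:Z * v 0%R j %/ e 0%R j)%Z.
have [_ _ [Y HY]] := HU.
exists m, (c *m Y); split.
  by apply: prodn_cond_gt0 => j ej; rewrite absz_gt0.
rewrite -mulmxA -HY mulmxA -scaler_nat natz aE scalemxAl; congr (_ *m _).
by apply/rowP => j; have := dv j; rewrite mul_mx_diag !mxE => dvj; rewrite divzK.
Qed.

(** A component is determined by its fixed coordinates. All of them are roots of unity of order
    dividing the product of the nonzero e_j, so powers of one primitive root list the
    possibilities. *)
Lemma finite_components (B : seq 'rV[int]_n) :
  finite_set [set K | exists x, Ttorus G B x /\ K = connected_component (Ttorus G B) x].
Proof.
have [U [e HU]] := stacked_basis_exists B.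
pose m := (\prod_(j | e 0%R j != 0%R) absz (e 0%R j))%N.
have m0 : leq 1 m by apply: prodn_cond_gt0 => j ej; rewrite absz_gt0.
have [z zP] := exists_prim_root CC m0.
pose g (k : {ffun 'I_n -> 'I_m}) := [set t | Ttorus G B t /\
  forall j, e 0 j != 0 -> hev t (row j U) = z ^+ k j].
apply: (@sub_finite_set _ _ (g @` setT)); last exact/finite_image/finite_finset.
move=> K [x [Tx ->]].
have /choice [k kP] : forall j, exists k : 'I_m, e 0 j != 0 -> hev x (row j U) = z ^+ k.
  move=> j; have [ej|ej] := eqVneq (e 0 j) 0; first by exists (Ordinal m0).
  have Gx : forall i, G (x 0 i) by case: Tx.
  have := proj1 (TtorusP HG HU Gx) Tx j; rewrite mxE => H.
  have {}H : hev x (row j U) ^+ absz (e 0 j) = 1.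
    have := H; case: (e 0 j) => i //=; rewrite NegzE -exprnN => /eqP.
    by rewrite invr_eq1 => /eqP.
  have {}H : hev x (row j U) ^+ m = 1 by rewrite /m (bigD1 j) //= exprM H expr1n.
  by have [i ->] := prim_rootP zP H; exists i.
exists [ffun j => k j] => //; apply/seteqP; split=> t /=.
  move=> [Tt tk]; apply/(componentP HG HU Tx); split=> // j ej.
  by rewrite tk // ffunE kP.
move/(componentP HG HU Tx) => [Tt tx]; split=> // j ej.
by rewrite tx // ffunE kP.
Qed.

End ComponentsTheory.

(** * Finite sums and Möbius functions of finite posets *)

Lemma fsbig_seqE (S : nmodType) (T : choiceType) (l : seq T) (A : set T) (F : T -> S) :
  uniq l -> A `<=` [set` l] ->
  \sum_(z \in A) F z = \sum_(z <- l | `[< A z >]) F z.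
Proof.
move=> lu Al; rewrite (fsbigE [seq z <- l | `[< A z >]]).
- rewrite big_filter_cond; apply: eq_bigl => z.
  by case: asboolP => //= Az; apply/mem_set.
- exact: filter_uniq.
- by move=> z /=; rewrite mem_filter => /andP[/asboolP].
- by move=> z Az; rewrite mem_filter (Al _ Az) andbT => /asboolP.
Qed.

Section FiniteMobius.
Variables (T : choiceType) (l : seq T) (le : T -> T -> Prop).
Hypothesis lu : uniq l.
Hypothesis le_refl : forall x, le x x.
Hypothesis le_trans : forall y x z, le x y -> le y z -> le x z.
Hypothesis le_anti : forall x y, le x y -> le y x -> x = y.

Lemma mobius_exists : exists mu : T -> T -> int,
  (forall x y, x \in l -> y \in l -> le x y ->
     \sum_(z <- l | `[< le x z >] && `[< le z y >]) mu x z = (x == y)%:R) /\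
  (forall x y, ~ le x y -> mu x y = 0).
Proof.
pose lt z y := `[< le z y >] && (z != y).
(* mu x y by recursion on a bound k for the number of elements below y. *)
pose f x := fix f k y : int := if x == y then 1 else if `[< le x y >] then
  (if k is k'.+1 then - \sum_(z <- l | `[< le x z >] && lt z y) f k' z else 0) else 0.
have lt_trans z y w : lt z y -> lt y w -> lt z w.
  move=> /andP[/asboolP zy nzy] /andP[/asboolP yw nyw]; apply/andP; split.
    by apply/asboolP; exact: le_trans zy yw.
  by apply: contraNneq nzy => zw; apply/eqP/le_anti => //; rewrite zw.
pose h y := size [seq z <- l | lt z y].
have h_lt z y : z \in l -> lt z y -> (h z < h y)%N.
  move=> zl zy; apply: (@uniq_leq_size _ (z :: [seq w <- l | lt w z])).
    by rewrite /= filter_uniq // mem_filter /lt eqxx andbF.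
  move=> w; rewrite inE !mem_filter => /orP[/eqP ->|/andP[wz ->]]; first by rewrite zy.
  by rewrite (lt_trans _ _ _ wz zy).
(* With nothing of [l] strictly below [y] the recursive sum is empty, which agrees with the value 0
   returned when the bound is exhausted. *)
have h0 x k y : h y = 0%N -> \sum_(z <- l | `[< le x z >] && lt z y) f x k z = 0.
  move=> /size0nil /eqP; rewrite -[_ == _]negbK -has_filter => /hasPn H.
  by rewrite big_seq_cond big1 // => z /andP[/H /negbTE ->]; rewrite andbF.
(* Once the bound reaches the height [h y] the value no longer depends on it, so [size l] serves for
   every [y]. *)
have fS x k k' y : (h y <= k)%N -> (h y <= k')%N -> f x k y = f x k' y.
  elim: k k' y => [|k IH] [|k'] y //=; case: ifP => // _; case: ifP => // _.
  - by rewrite leqn0 => /eqP hy _; rewrite h0 // oppr0.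
  - by move=> _; rewrite leqn0 => /eqP hy; rewrite h0 // oppr0.
  - move=> hk hk'; congr (- _); rewrite big_seq_cond [RHS]big_seq_cond.
    apply: eq_bigr => z /andP[zl /andP[_ zy]].
    by apply: IH; rewrite -ltnS (leq_trans (h_lt _ _ zl zy)).
have hs y : (h y <= size l)%N by rewrite /h size_filter count_size.
exists (fun x y => f x (size l) y); split => x y; last first.
  move=> nxy; case: (size l) => [|k] /=; case: eqP => [xy|_].
  - by case: nxy; rewrite xy.
  - by case: asboolP.
  - by case: nxy; rewrite xy.
  - by case: asboolP.
move=> xl yl xy; have [exy|nxy] := eqVneq x y.
  subst y; rewrite (big_rem x) //= !asboolT //= big_seq_cond big1 ?addr0.
    by case: (size l) => [|k] /=; rewrite eqxx.
  move=> z; rewrite mem_rem_uniq // inE => /andP[/andP[/negP nzx _] /andP[/asboolP xz /asboolP zx]].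
  by case: nzx; apply/eqP; exact: le_anti.
rewrite (bigID (pred1 y)) /= -big_filter.
have -> : [seq z <- l | `[< le x z >] && `[< le z y >] & z == y] = [:: y].
  rewrite -[RHS](filter_pred1_uniq lu yl); apply: eq_filter => z /=.
  by case: eqP => [->|]; rewrite ?andbF // !asboolT.
(* Raising the bound by one for the term at [y] unfolds the recursion once, and that term cancels
   the sum over the elements strictly below [y]. *)
rewrite big_seq1 (fS x _ (size l).+1) ?(leq_trans (hs y)) //=.
rewrite (negbTE nxy) asboolT //.
rewrite [X in _ + X](eq_bigl (fun z => `[< le x z >] && lt z y)) ?addNr // => z.
by rewrite /lt andbA.
Qed.

End FiniteMobius.

(** This translates between the two counts: the character value is [z] raised to the pairing of [v]
    with [k], and [z] has order [q]. *)
Lemma hev_root_point (R : realType) n q (z : R[i]) (k : {ffun 'I_n -> 'I_q})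
    (v : 'rV[int]_n) : q.-primitive_root z ->
  (hev (root_point z k) v == 1) = (q%:Z %| \sum_(i < n) v 0 i * (k i : nat)%:Z)%Z.
Proof.
move=> zP; have z0 : z != 0 by rewrite (prim_root_eq0 zP) -lt0n (prim_order_gt0 zP).
have -> : hev (root_point z k) v = z ^ (\sum_(i < n) v 0 i * (k i : nat)%:Z).
  rewrite (big_morph (fun m : int => z ^ m) (fun a b => expfzDr a b z0) (expr0z z)).
  by apply: eq_bigr => i _; rewrite mxE -[_ ^+ _]/(z ^ (k i : nat)%:Z) exprz_exp mulrC.
case: (\sum_(_ < _) _) => m; first by rewrite dvdzE /= (prim_order_dvd zP).
by rewrite NegzE -exprnN invr_eq1 -(prim_order_dvd zP) dvdzE abszN.
Qed.

(** * The poset of flats and the evaluation at q *)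

Section Arrangement.
Variables (R : realType) (n : nat).
Local Notation CC := R[i].
Variables (G : set CC) (Rel A : seq 'rV[int]_n).
Hypothesis HG : G = [set z : CC | `|z| = 1] \/ G = [set z : CC | z != 0].
Local Notation T := (Ttorus G Rel).
Local Notation L := (Lset G Rel A).
Local Notation HS := (HS G Rel).

(** Passing to the quotient of Gamma by [S] makes the results on a single group available for every
    intersection. *)
Lemma HSE S : HS S = Ttorus G (S ++ Rel).
Proof.
apply/seteqP; split=> t /=.
  by move=> [[Gt tR] tS]; split => // b; rewrite mem_cat => /orP[]; [exact: tS | exact: tR].
move=> [Gt tB]; split; first split => //.
  by move=> r rR; apply: tB; rewrite mem_cat rR orbT.
by move=> a aS; apply: tB; rewrite mem_cat aS.
Qed.

(** [S] may repeat or reorder elements, but [HS S] depends only on its set of entries, so finitely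
    many masks of [A] give all intersections. *)
Lemma finite_Lset : finite_set L.
Proof.
apply: (@sub_finite_set _ _ (\bigcup_(m in [set: (size A).-tuple bool])
  [set K | exists x, HS (mask m A) x /\ K = connected_component (HS (mask m A)) x])).
  move=> K [S [sS [x [Sx ->]]]].
  have Sm : size [seq a \in S | a <- A] == size A by rewrite size_map.
  have SE : HS S = HS (mask (Tuple Sm) A).
    apply/seteqP; split=> t [Tt tS]; split => // a aS; apply: tS.
      by move: aS; rewrite /= -filter_mask mem_filter => /andP[].
    by rewrite /= -filter_mask mem_filter aS sS.
  by exists (Tuple Sm) => //; exists x; rewrite -SE.
apply: bigcup_finite; first exact: finite_finset.
move=> m _; rewrite HSE; exact: finite_components.
Qed.

Lemma Lset_enum : exists2 l : seq (set 'rV[CC]_n), uniq l & L = [set` l].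
Proof.
have [X ->] := proj1 finite_fsetP finite_Lset.
by exists (finmap.enum_fset X) => //; exact: finmap.fset_uniq.
Qed.

Lemma Lset_conn K t : L K -> K t -> exists S,
  [/\ {subset S <= A}, HS S t & K = connected_component (HS S) t].
Proof.
move=> [S [sS [x [Sx ->]]]] xt; exists S; split=> //.
  exact: connected_component_sub xt.
exact: same_connected_component.
Qed.

Lemma HS_sub S : HS S `<=` T.
Proof. by move=> t []. Qed.

Lemma HS_mono S S' : {subset S <= S'} -> HS S' `<=` HS S.
Proof. by move=> sS t [Tt tS]; split=> // a /sS; exact: tS. Qed.

Lemma connected_component_subset (X Y : set 'rV[CC]_n) t :
  X `<=` Y -> connected_component X t `<=` connected_component Y t.
Proof. by move=> XY y [C [Ct CX cC] Cy]; exists C => //; split=> // w /CX /XY. Qed.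

(** As [K] is connected, its points share one component of T and the union defining [Tcomp] has
    equal terms. *)
Lemma TcompE K t : L K -> K t -> Tcomp G Rel K = connected_component T t.
Proof.
move=> LK Kt; have [S [_ _ KE]] := Lset_conn LK Kt.
have Kcc y : K y -> connected_component T t y.
  by rewrite KE; apply: connected_component_subset; exact: HS_sub.
apply/seteqP; split=> y.
  by move=> [w /Kcc Kw]; rewrite (same_connected_component Kw).
by move=> ty; exists t.
Qed.

Lemma Ttorus_comp_Lset t : T t -> L (connected_component T t).
Proof.
move=> Tt; exists [::]; split=> //; exists t; split; first by split.
by rewrite HSE.
Qed.

Lemma zrank_subset (B B' : seq 'rV[int]_n) : {subset B <= B'} -> (zrank B <= zrank B')%N.
Proof.
move=> sB; rewrite !zrankE; apply: mxrankS; apply/row_subP => i.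
have [j ij] := mem_rows (sB _ (rows_mem i)).
by rewrite -map_row ij map_row row_sub.
Qed.

(** [ldim] uses all elements of [A] trivial on the component, possibly more than [S]. By saturation
    each of them has a positive multiple in the lattice of [S ++ Rel], so the rank is unchanged. *)
Lemma ldimE S x : {subset S <= A} -> HS S x ->
  ldim G Rel A (connected_component (HS S) x) = (n - zrank (S ++ Rel))%N.
Proof.
move=> sS Sx; rewrite /ldim /rank_Gamma /rank_sub.
set V := vanishing _ _ _ _.
have -> : zrank (V ++ Rel) = zrank (S ++ Rel).
  apply: zrank_sat => [b|b].
    rewrite !mem_cat => /orP[bS|->]; last by rewrite orbT.
    apply/orP; left; rewrite mem_filter sS // andbT; apply/asboolP => t xt.
    by have [Tt tS] := connected_component_sub xt; split=> //; exact: tS.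
  rewrite mem_cat => /orP[|bR].
    rewrite mem_filter => /andP[/asboolP bV _].
    rewrite HSE in Sx bV; apply: (component_vanish_sat HG Sx) => t xt.
    by have [] := bV t xt.
  have [i ->] : exists i, b = row i (rows (S ++ Rel)).
    by apply: mem_rows; rewrite mem_cat bR orbT.
  by exists 1%N, (delta_mx 0 i); rewrite -rowE.
have le : (zrank Rel <= zrank (S ++ Rel))%N.
  by apply: zrank_subset => b bR; rewrite mem_cat bR orbT.
(* By [le] the truncated subtraction in [rank_sub] is exact. *)
by rewrite -subnDA subnKC.
Qed.

Definition stab (t : 'rV[CC]_n) := [seq a <- A | hev t a == 1].
(** The smallest flat through [t], that is, the largest one for reverse inclusion. *)
Definition flat (t : 'rV[CC]_n) := connected_component (HS (stab t)) t.

Lemma HS_stab t : T t -> HS (stab t) t.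
Proof. by move=> Tt; split=> // a; rewrite mem_filter => /andP[/eqP]. Qed.

Lemma flat_Lset t : T t -> L (flat t).
Proof.
move=> Tt; exists (stab t); split; first by move=> a; rewrite mem_filter => /andP[].
by exists t; split=> //; exact: HS_stab.
Qed.

(** Based at [t], a flat through [t] comes from some [S] contained in [stab t], which places it in
    the interval. Conversely, anything containing [flat t] contains [t]. *)
Lemma flat_interval K t : T t -> L K ->
  K t <-> Lle (connected_component T t) K /\ Lle K (flat t).
Proof.
move=> Tt LK; split=> [Kt|[_ tK]]; last first.
  by apply: tK; apply: connected_component_refl; exact: HS_stab.
have [S [sS St KE]] := Lset_conn LK Kt; rewrite KE; split.
  by apply: connected_component_subset; exact: HS_sub.
apply: connected_component_subset; apply: HS_mono => a aS.
by rewrite mem_filter sS // andbT; have [_ ->] := St.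
Qed.

(** If the component equals [flat t], an element of [A] trivial at [t] is trivial on the whole
    component, hence torsion by saturation, contradicting [scc]. If no element is trivial at [t],
    then [stab t] is empty. *)
Lemma scc_flat t : T t ->
  (scc G Rel A (connected_component T t) /\ connected_component T t = flat t) <->
  (forall a, a \in A -> hev t a != 1).
Proof.
move=> Tt; split=> [[[_ nt] tE] a aA|tA].
  apply/negP => /eqP ta; apply: nt.
  have sub : connected_component T t `<=` Hsub G Rel a.
    rewrite tE => y /connected_component_sub [Ty yS]; split=> //.
    by apply: yS; rewrite mem_filter aA ta eqxx.
  exists a; split=> //; split=> //.
  have [m [c [m0 mc]]] := component_vanish_sat HG Tt (fun y ty => (sub y ty).2).
  exists m; split=> //; exists (fun j => c 0 j).
  rewrite mc mulmx_sum_row; apply: eq_bigr => j _.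
  by rewrite rowK -scaler_int intz.
split.
  split; first by exists t.
  move=> [a [aA [_ sub]]].
  have [_ /eqP ta] := sub t (connected_component_refl Tt).
  by have := tA a aA; rewrite ta.
have -> : flat t = connected_component (HS [::]) t.
  rewrite /flat; congr (connected_component (HS _) t).
  apply/eqP; rewrite -[_ == _]negbK -has_filter; apply/hasPn => a aA.
  exact: tA.
by rewrite HSE.
Qed.

Lemma Lle_sum (l : seq (set 'rV[CC]_n)) (F : set 'rV[CC]_n -> int) x y :
  uniq l -> L = [set` l] ->
  \sum_(z \in [set z | L z /\ Lle x z /\ Lle z y]) F z =
  \sum_(z <- l | `[< Lle x z >] && `[< Lle z y >]) F z.
Proof.
move=> lu lL; rewrite (fsbig_seqE (l := l)) //; last by move=> z [Lz _]; rewrite -lL.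
rewrite big_seq_cond [RHS]big_seq_cond; apply: eq_bigl => z.
have [zl|//] := boolP (z \in l); rewrite /= -asbool_and; apply: asbool_equiv_eq.
by split=> [[]//|H]; split=> //; rewrite lL.
Qed.

Lemma is_mobius_exists : exists mu, is_mobius G Rel A mu.
Proof.
have [l lu lL] := Lset_enum.
have LleA (x y : set 'rV[CC]_n) : Lle x y -> Lle y x -> x = y.
  by move=> xy yx; apply/seteqP; split.
have LleT (y x z : set 'rV[CC]_n) : Lle x y -> Lle y z -> Lle x z.
  by move=> xy yz; exact: subset_trans yz xy.
have [mu [mu1 mu0]] := @mobius_exists _ l (@Lle R n) lu (fun x => @subset_refl _ x) LleT LleA.
exists mu; split=> [x y Lx Ly xy|x y _ _]; last exact: mu0.
rewrite (Lle_sum _ x y lu lL) mu1 //; [|by move: Lx; rewrite lL|by move: Ly; rewrite lL].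
by case: eqP => [xE|xE]; case: asboolP.
Qed.

(** This lets the condition defining [Lpark] and the power of q be absorbed together into a count of
    torsion points. *)
Lemma card_torsion_points K q (z : CC) : q.-primitive_root z -> Lpar G Rel A K ->
  #|[pred k : {ffun 'I_n -> 'I_q} | `[< K (root_point z k) >]]| =
  (if `[< Lpark G Rel A q%:Z K >] then q ^ ldim G Rel A K else 0)%N.
Proof.
move=> zP LK; have [[S [sS [x [Sx KE]]]] _] := LK.
case: asboolP => [[_ [t [Kt tq]]]|nK]; last first.
  apply: eq_card0 => k; rewrite !inE; apply/asboolP => Kk; apply: nK; split=> //.
  by exists (root_point z k); split=> // i; exact: root_pointX.
have [k0 tk0] := root_point_surj zP (t := t) tq.
rewrite KE ldimE //; rewrite KE tk0 in Kt; rewrite HSE in Sx Kt *.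
exact: (card_component_root_points HG zP Sx Kt).
Qed.

Lemma chi_par_horner mu q : is_mobius G Rel A mu -> (0 < q)%N ->
  (chi_par G Rel A mu q%:Z).[q%:Z] = (chi_quasi Rel A q)%:Z.
Proof.
move=> [mu1 _] q0; have [l lu lL] := Lset_enum.
have [z zP] := exists_prim_root CC q0.
pose pt := @root_point R n q z.
rewrite /chi_par (fsbig_seqE (l := l)) //; last by move=> K [[LK _] _]; rewrite -lL.
rewrite horner_sum.
transitivity (\sum_(K <- l | `[< Lpar G Rel A K >])
    \sum_(k : {ffun 'I_n -> 'I_q} | `[< K (pt k) >]) mu (Tcomp G Rel K) K).
  rewrite (eq_bigl (fun K => `[< Lpar G Rel A K >] && `[< Lpark G Rel A q%:Z K >])); last first.
    move=> K; rewrite -asbool_and; apply: asbool_equiv_eq.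
    by split=> [H|[]//]; split=> //; case: H.
  rewrite big_mkcondr; apply: eq_bigr => K /asboolP LK.
  rewrite sumr_const (card_torsion_points zP LK).
  case: asboolP => _; last by rewrite mulr0n.
  by rewrite hornerM hornerC hornerXn -mulr_natr natrX natz.
(* From here the sum runs over torsion points first, and the two sides are compared point by
   point. *)
rewrite (exchange_big_dep predT) //=.
rewrite /chi_quasi -sum1_card -natz natr_sum [RHS]big_mkcond /=.
apply: eq_bigr => k _; set P := (X in if X then _ else _).
have ptG i : G (pt k 0 i) by exact: (G_unity HG q0 (root_pointX zP k i)).
have PE : P = `[< T (pt k) /\ forall a, a \in A -> hev (pt k) a != 1 >].
  apply/idP/asboolP.
    move=> /set_mem /andP[/allP kR /allP kA]; split; first split => //.
      by move=> r /kR; rewrite -(hev_root_point k r zP) => /eqP.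
    by move=> a /kA; rewrite -(hev_root_point k a zP).
  move=> [[_ tR] tA]; apply/mem_set/andP; split; apply/allP => v vB.
    by rewrite -(hev_root_point k v zP); apply/eqP; exact: tR.
  by rewrite -(hev_root_point k v zP); exact: tA.
rewrite PE; case: (pselect (T (pt k))) => [Tk|nTk]; last first.
  rewrite asboolF; last by case.
  rewrite big_seq_cond big1 // => K /andP[Kl /andP[_ /asboolP Kk]]; case: nTk.
  have LK : L K by rewrite lL.
  by have [S [_ [Tk _] _]] := Lset_conn LK Kk.
set D := connected_component T (pt k).
have [LD Lf] : L D /\ L (flat (pt k)) by split; [exact: Ttorus_comp_Lset | exact: flat_Lset].
case: (pselect (scc G Rel A D)) => [sD|nsD]; last first.
  rewrite asboolF; last by move=> [_ /(scc_flat Tk)] [].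
  rewrite big_seq_cond big1 // => K /andP[Kl /andP[/asboolP[LK sK] /asboolP Kk]]; case: nsD.
  by rewrite /D -(TcompE LK Kk).
have Df : Lle D (flat (pt k)).
  by apply: connected_component_subset; exact: HS_sub.
(* All flats through the point have [D] as their component of T, so [Lpar] imposes no further
   condition and the sum runs over a full interval starting at [D]. *)
transitivity (\sum_(K <- l | `[< Lle D K >] && `[< Lle K (flat (pt k)) >]) mu D K).
  rewrite big_seq_cond [RHS]big_seq_cond; apply: eq_big => [K|K].
    have [Kl|//] := boolP (K \in l); rewrite /= -!asbool_and; apply: asbool_equiv_eq.
    have LK : L K by rewrite lL.
    split=> [[_ /(flat_interval Tk LK)]//|/(flat_interval Tk LK) Kk].
    by split=> //; split=> //; rewrite (TcompE LK Kk).
  move=> /andP[Kl /andP[/asboolP[LK _] /asboolP Kk]].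
  by rewrite (TcompE LK Kk).
rewrite -(Lle_sum _ _ _ lu lL) mu1 //; congr (if _ then _ else _).
apply: asbool_equiv_eq; split=> [DE|[_ tA]].
  by split=> //; apply/(scc_flat Tk).
by have [_] := proj2 (scc_flat Tk) tA.
Qed.

End Arrangement.

(** The Möbius function enters through its defining property; the existence clause keeps the second
    clause from being vacuous. *)
Theorem theorem4p8 (R : realType) (n : nat) (Rel A : seq 'rV[int]_n)
  (G : set R[i])
  (HG : G = [set z : R[i] | `|z| = 1] \/ G = [set z : R[i] | z != 0])
  (q : nat) (hq : (0 < q)%N) :
  (exists mu, is_mobius G Rel A mu) /\
  forall mu, is_mobius G Rel A mu ->
    (chi_par G Rel A mu q%:Z).[q%:Z] = (chi_quasi Rel A q)%:Z.
Proof.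
split; first exact: is_mobius_exists.
by move=> mu muP; exact: chi_par_horner.
Qed.
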